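(* The finite state model checking problem for mumbling $H_\mu$ (without restricting to a single successor assignment) is undecidable: there is no algorithm that, given a closed mumbling $H_\mu$ hyperproperty formula $\varphi$ and a finite Kripke structure $\mathcal{K}$, decides whether $\mathit{Traces}(\mathcal{K}) \models \varphi$.
   Context: Mumbling $H_\mu$ is a hyperlogic with three formula levels. Trace formulae are $\delta ::= \mathit{ap} \mid Y \mid \delta \lor \delta \mid \lnot\delta \mid \bigcirc^{\mathsf{f}}\delta \mid \mu Y.\delta$ with $\mathsf{f}\in\{\mathsf{g},\mathsf{a},\mathsf{c}\}$ (global successor, abstract successor, caller), i.e. a linear-time $\mu$-calculus with CaRet-like modalities, interpreted on single traces. Multitrace formulae are $\psi ::= [\delta]_\pi \mid X \mid \psi\lor\psi \mid \lnot\psi \mid \bigcirc^{\Delta}\psi \mid \mu X.\psi$, where $[\delta]_\pi$ tests $\delta$ at the current position of trace $\pi$, and $\Delta$ is a successor assignment mapping each trace variable $\pi$ to a trace formula; $\bigcirc^\Delta\psi$ advances every trace $\pi$ simultaneously to the next position where $\Delta(\pi)$ holds (or to the immediate successor position if no such later position exists) and evaluates $\psi$ there. Hyperproperty formulae are $\varphi ::= \exists\pi.\varphi \mid \forall\pi.\varphi \mid \psi$, with trace quantifiers ranging over the traces of the model; $\varphi$ holds if $\psi$ holds at the initial positions $(0,\dots,0)$. Here different $\bigcirc^\Delta$ operators in a formula may use different successor assignments $\Delta$. On Kripke structures (finite state systems with only internal transitions), the finite state model checking problem asks, given a closed formula $\varphi$ and a (possibly fair) Kripke structure $\mathcal{K}$,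 whether the set of traces of $\mathcal{K}$ satisfies $\varphi$. *)

(* Defs.v *)
From mathcomp Require Import all_boot.

Set Implicit Arguments.
Unset Strict Implicit.
Unset Printing Implicit Defensive.

Inductive ptype := PCall | PRet | PInt.

(* tlab w i a : atomic proposition a (a natural number) holds at position i *)
Record trace := Trace { tlab : nat -> nat -> Prop; ttyp : nat -> ptype }.

Definition isCall (p : ptype) : bool := if p is PCall then true else false.
Definition isRet (p : ptype) : bool := if p is PRet then true else false.

Definition cntC (w : trace) (a b : nat) : nat := \sum_(a <= k < b) isCall (ttyp w k).
Definition cntR (w : trace) (a b : nat) : nat := \sum_(a <= k < b) isRet (ttyp w k).

Definition matched (w : trace) (i j : nat) : Prop :=
  [/\ ttyp w i = PCall, i < j, ttyp w j = PRet,
      cntR w i.+1 j.+1 = (cntC w i.+1 j.+1).+1 &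
      forall k, i < k < j -> cntR w i.+1 k.+1 <= cntC w i.+1 k.+1].

Definition pending (w : trace) (j i : nat) : Prop :=
  [/\ j < i, ttyp w j = PCall & ~ (exists m, matched w j m /\ m <= i)].

(* successor kinds: global, abstract, caller *)
Inductive succ_kind := Sg | Sa | Sc.

(* succ f w i j : j is the f-successor of position i (CaRet successors);
   no such j exists when the successor is undefined *)
Definition succ (f : succ_kind) (w : trace) (i j : nat) : Prop :=
  match f with
  | Sg => j = i.+1
  | Sa => if isCall (ttyp w i) then matched w i j
          else ttyp w i.+1 <> PRet /\ j = i.+1
  | Sc => pending w j i /\ (forall j', pending w j' i -> j' <= j)
  end.

Definition adv (D : nat -> Prop) (i j : nat) : Prop :=
  (i < j /\ D j /\ (forall k, i < k < j -> ~ D k))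
  \/ (j = i.+1 /\ (forall k, i < k -> ~ D k)).

Definition upd {A : Type} (e : nat -> A) (x : nat) (v : A) : nat -> A :=
  fun y => if y == x then v else e y.

Inductive tf :=
| TAp of nat
| TVar of nat
| TOr of tf & tf
| TNeg of tf
| TNext of succ_kind & tf
| TMu of nat & tf.

(* successor assignment: finite map from trace variables to trace formulae *)
Definition succ_assign := seq (nat * tf).

Fixpoint lookup (D : succ_assign) (p : nat) : option tf :=
  match D with
  | [::] => None
  | (q, d) :: D' => if q == p then Some d else lookup D' p
  end.

Inductive mf :=
| MTest of tf & nat
| MVar of nat
| MOr of mf & mf
| MNeg of mf
| MNext of succ_assign & mf
| MMu of nat & mf.

Inductive hf :=
| HEx of nat & hf
| HAll of nat & hf
| HBase of mf.

Fixpoint tpolar (Y : nat) (b : bool) (d : tf) : bool :=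
  match d with
  | TAp _ => true
  | TVar Y' => (Y' == Y) ==> b
  | TOr d1 d2 => tpolar Y b d1 && tpolar Y b d2
  | TNeg d1 => tpolar Y (~~ b) d1
  | TNext _ d1 => tpolar Y b d1
  | TMu Y' d1 => (Y' == Y) || tpolar Y b d1
  end.

Fixpoint tf_wf (B : seq nat) (d : tf) : bool :=
  match d with
  | TAp _ => true
  | TVar Y => Y \in B
  | TOr d1 d2 => tf_wf B d1 && tf_wf B d2
  | TNeg d1 => tf_wf B d1
  | TNext _ d1 => tf_wf B d1
  | TMu Y d1 => tpolar Y true d1 && tf_wf (Y :: B) d1
  end.

Definition tf_closed (d : tf) : bool := tf_wf [::] d.

Fixpoint mpolar (X : nat) (b : bool) (m : mf) : bool :=
  match m with
  | MTest _ _ => true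
  | MVar X' => (X' == X) ==> b
  | MOr m1 m2 => mpolar X b m1 && mpolar X b m2
  | MNeg m1 => mpolar X (~~ b) m1
  | MNext _ m1 => mpolar X b m1
  | MMu X' m1 => (X' == X) || mpolar X b m1
  end.

Fixpoint mf_wf (P B : seq nat) (m : mf) : bool :=
  match m with
  | MTest d p => tf_closed d && (p \in P)
  | MVar X => X \in B
  | MOr m1 m2 => mf_wf P B m1 && mf_wf P B m2
  | MNeg m1 => mf_wf P B m1
  | MNext D m1 =>
      all (fun p => isSome (lookup D p)) P && all (fun q => tf_closed q.2) D
      && mf_wf P B m1
  | MMu X m1 => mpolar X true m1 && mf_wf P (X :: B) m1
  end.

Fixpoint hf_wf (P : seq nat) (h : hf) : bool :=
  match h with
  | HEx p h1 => hf_wf (p :: P) h1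
  | HAll p h1 => hf_wf (p :: P) h1
  | HBase m => mf_wf P [::] m
  end.

Definition hf_closed (h : hf) : bool := hf_wf [::] h.

(* set of positions of w satisfying d; least fixpoints as intersections of
   all pre-fixed points (Knaster-Tarski) *)
Fixpoint tsem (w : trace) (e : nat -> nat -> Prop) (d : tf) : nat -> Prop :=
  match d with
  | TAp a => fun i => tlab w i a
  | TVar Y => e Y
  | TOr d1 d2 => fun i => tsem w e d1 i \/ tsem w e d2 i
  | TNeg d1 => fun i => ~ tsem w e d1 i
  | TNext f d1 => fun i => exists j, succ f w i j /\ tsem w e d1 j
  | TMu Y d1 => fun i => forall S : nat -> Prop,
        (forall k, tsem w (upd e Y S) d1 k -> S k) -> S i
  end.

Definition tenv0 : nat -> nat -> Prop := fun _ _ => False.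

Definition delta_set (w : trace) (D : succ_assign) (p : nat) : nat -> Prop :=
  match lookup D p with
  | Some d => tsem w tenv0 d
  | None => fun _ => False
  end.

Fixpoint msem (Pi : nat -> trace) (E : nat -> (nat -> nat) -> Prop) (m : mf)
  : (nat -> nat) -> Prop :=
  match m with
  | MTest d p => fun v => tsem (Pi p) tenv0 d (v p)
  | MVar X => E X
  | MOr m1 m2 => fun v => msem Pi E m1 v \/ msem Pi E m2 v
  | MNeg m1 => fun v => ~ msem Pi E m1 v
  | MNext D m1 => fun v => exists v' : nat -> nat,
        (forall p, adv (delta_set (Pi p) D p) (v p) (v' p)) /\ msem Pi E m1 v'
  | MMu X m1 => fun v => forall S : (nat -> nat) -> Prop,
        (forall u, msem Pi (upd E X S) m1 u -> S u) -> S v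
  end.

Definition menv0 : nat -> (nat -> nat) -> Prop := fun _ _ => False.

Fixpoint hsat (T : trace -> Prop) (Pi : nat -> trace) (h : hf) : Prop :=
  match h with
  | HEx p h1 => exists t, T t /\ hsat T (upd Pi p t) h1
  | HAll p h1 => forall t, T t -> hsat T (upd Pi p t) h1
  | HBase m => msem Pi menv0 m (fun _ => 0)
  end.

Definition dummy_trace : trace := Trace (fun _ _ => False) (fun _ => PInt).

Definition models (T : trace -> Prop) (h : hf) : Prop :=
  hsat T (fun _ => dummy_trace) h.

(* states 0 .. kn-1; initial states; edges; labeling: state s is labelled by
   the atomic propositions in nth [::] klab s *)
Record kripke := Kripke {
  kn : nat;
  kinit : seq nat;
  kedge : seq (nat * nat);
  klab : seq (seq nat) }.

Definition kripke_wf (K : kripke) : Prop :=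
  forall s, s < kn K -> exists t, t < kn K /\ (s, t) \in kedge K.

Definition Traces (K : kripke) : trace -> Prop := fun w =>
  exists p : nat -> nat,
    [/\ p 0 \in kinit K,
        forall i, p i < kn K /\ (p i, p i.+1) \in kedge K,
        forall i a, tlab w i a <-> a \in nth [::] (klab K) (p i) &
        forall i, ttyp w i = PInt].

(** * Encoding of instances into natural numbers (Cantor pairing)           *)

Definition cpair (x y : nat) : nat := (x + y) * (x + y).+1 %/ 2 + y.

Definition enc_sk (f : succ_kind) : nat :=
  match f with Sg => 0 | Sa => 1 | Sc => 2 end.

Fixpoint enc_list {A : Type} (g : A -> nat) (s : seq A) : nat :=
  match s with
  | [::] => 0
  | x :: s' => (cpair (g x) (enc_list g s')).+1
  end.

Fixpoint enc_tf (d : tf) : nat :=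
  match d with
  | TAp a => cpair 0 a
  | TVar Y => cpair 1 Y
  | TOr d1 d2 => cpair 2 (cpair (enc_tf d1) (enc_tf d2))
  | TNeg d1 => cpair 3 (enc_tf d1)
  | TNext f d1 => cpair 4 (cpair (enc_sk f) (enc_tf d1))
  | TMu Y d1 => cpair 5 (cpair Y (enc_tf d1))
  end.

Definition enc_sa (D : succ_assign) : nat :=
  enc_list (fun q => cpair q.1 (enc_tf q.2)) D.

Fixpoint enc_mf (m : mf) : nat :=
  match m with
  | MTest d p => cpair 0 (cpair (enc_tf d) p)
  | MVar X => cpair 1 X
  | MOr m1 m2 => cpair 2 (cpair (enc_mf m1) (enc_mf m2))
  | MNeg m1 => cpair 3 (enc_mf m1)
  | MNext D m1 => cpair 4 (cpair (enc_sa D) (enc_mf m1))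
  | MMu X m1 => cpair 5 (cpair X (enc_mf m1))
  end.

Fixpoint enc_hf (h : hf) : nat :=
  match h with
  | HEx p h1 => cpair 0 (cpair p (enc_hf h1))
  | HAll p h1 => cpair 1 (cpair p (enc_hf h1))
  | HBase m => cpair 2 (enc_mf m)
  end.

Definition enc_kripke (K : kripke) : nat :=
  cpair (kn K)
    (cpair (enc_list id (kinit K))
       (cpair (enc_list (fun e => cpair e.1 e.2) (kedge K))
          (enc_list (enc_list id) (klab K)))).

Definition enc_instance (h : hf) (K : kripke) : nat :=
  cpair (enc_hf h) (enc_kripke K).

Inductive prf :=
| PZero
| PSucc
| PProj of nat
| PComp of prf & seq prf
| PRec of prf & prf
| PMu of prf.

Inductive peval : prf -> seq nat -> nat -> Prop :=
| ev_zero xs : peval PZero xs 0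
| ev_succ x xs : peval PSucc (x :: xs) x.+1
| ev_proj i xs : i < size xs -> peval (PProj i) xs (nth 0 xs i)
| ev_comp f gs xs ys y :
    pevals gs xs ys -> peval f ys y -> peval (PComp f gs) xs y
| ev_rec0 f g xs y : peval f xs y -> peval (PRec f g) (0 :: xs) y
| ev_recS f g n xs z y :
    peval (PRec f g) (n :: xs) z -> peval g (n :: z :: xs) y ->
    peval (PRec f g) (n.+1 :: xs) y
| ev_mu f xs n :
    peval f (n :: xs) 0 ->
    (forall m, m < n -> exists k, peval f (m :: xs) k.+1) ->
    peval (PMu f) xs n
with pevals : seq prf -> seq nat -> seq nat -> Prop :=
| evs_nil xs : pevals [::] xs [::]
| evs_cons g gs xs y ys :
    peval g xs y -> pevals gs xs ys -> pevals (g :: gs) xs (y :: ys).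

Definition decidable_nat (P : nat -> Prop) : Prop :=
  exists f : prf, forall n,
    (P n -> peval f [:: n] 1) /\ (~ P n -> peval f [:: n] 0).

Definition MC_problem : nat -> Prop := fun n =>
  exists (h : hf) (K : kripke),
    [/\ n = enc_instance h K, hf_closed h, kripke_wf K & models (Traces K) h].

(* Main.v *)
Require Import Defs.
From mathcomp Require Import all_boot.
From mathcomp Require Import zify.
From Stdlib Require Import Classical.

(** A decider [f] is refuted by diagonalisation. Every recursive function is
    computed by a register program, and a program [c] is turned into a formula
    [prog_hf k c] that holds on the Kripke structure [input_kripke n] iff [c]
    halts with output 0 when started with [n] in all registers. The formula
    guesses, for each register, a trace listing its successive values in unary,
    twice: one head stays one block behind the other, so that each step of the
    program compares the old values with the new ones position by position.
    The control flow of the program is in the formula, loops being fixpoints.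
    Blocks have different lengths, which is where two successor assignments are
    needed: one advances all heads by one position, the other by one block.
    As the input is carried by the Kripke structure alone, [n] can be the code
    of the formula of the program that runs [f] on the instance with code [n]
    and Kripke structure [input_kripke n]. *)

Set Implicit Arguments.
Unset Strict Implicit.
Unset Printing Implicit Defensive.

(** * Register programs *)

Inductive expr := EZero | ESum of nat & bool.

Inductive cmd :=
| CSkip
| CSet of nat & expr
| CSeq of cmd & cmd
| CWhile of nat & nat & cmd.

Definition store := nat -> nat.

Definition eval (e : expr) (s : store) : nat :=
  match e with EZero => 0 | ESum r b => s r + b end.

(* [exec c s l s']: from [s], [c] halts in [s'], and [l] lists the stores
   reached after each assignment. *)
Inductive exec : cmd -> store -> seq store -> store -> Prop :=
| ex_skip s : exec CSkip s [::] s
| ex_set r e s (s' := upd s r (eval e s)) : exec (CSet r e) s [:: s'] s'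
| ex_seq c1 c2 s l1 s1 l2 s2 :
    exec c1 s l1 s1 -> exec c2 s1 l2 s2 -> exec (CSeq c1 c2) s (l1 ++ l2) s2
| ex_stop r q c s : s r = s q -> exec (CWhile r q c) s [::] s
| ex_loop r q c s l1 s1 l2 s2 :
    s r <> s q -> exec c s l1 s1 -> exec (CWhile r q c) s1 l2 s2 ->
    exec (CWhile r q c) s (l1 ++ l2) s2.

Definition halts_in (c : cmd) (s s' : store) : Prop := exists l, exec c s l s'.

Lemma halts_seq c1 c2 s s2 :
  halts_in (CSeq c1 c2) s s2 <->
  exists s1, halts_in c1 s s1 /\ halts_in c2 s1 s2.
Proof.
split=> [[l H]|[s1 [[l1 H1] [l2 H2]]]]; last by exists (l1 ++ l2); apply: ex_seq H2.
by inversion H; subst; exists s1; split; [exists l1|exists l2].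
Qed.

Lemma halts_set r e s s' :
  halts_in (CSet r e) s s' <-> s' = upd s r (eval e s).
Proof.
split=> [[l H]|->]; first by inversion H.
by exists [:: upd s r (eval e s)]; constructor.
Qed.

Lemma halts_while r q c s s2 :
  halts_in (CWhile r q c) s s2 <->
  (s r = s q /\ s2 = s) \/
  (s r <> s q /\ exists s1, halts_in c s s1 /\ halts_in (CWhile r q c) s1 s2).
Proof.
split=> [[l H]|].
- inversion H; subst; [by left|right]; split=> //.
  by exists s1; split; [exists l1|exists l2].
- case=> [[E ->]|[N [s1 [[l1 H1] [l2 H2]]]]]; first by exists [::]; constructor.
  by exists (l1 ++ l2); apply: ex_loop H2.
Qed.

(** The formula only says that some halting run ends with output 0; determinism identifies this run
    with the one whose output the decider prescribes. *)
Lemma exec_det c s l1 s1 s2 : exec c s l1 s1 -> halts_in c s s2 -> s1 = s2.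
Proof.
move=> H; elim: H s2 => {c s l1 s1}.
- by move=> s s2 [l H]; inversion H.
- by move=> r e s s' s2 /halts_set.
- move=> c1 c2 s l1 s1 l2 s2 _ IH1 _ IH2 s3 /halts_seq [t [/IH1 <-]].
  exact: IH2.
- by move=> r q c s E s2 /halts_while [[_ ->]|[]].
- move=> r q c s l1 s1 l2 s2 N _ IH1 _ IH2 s3.
  by move=> /halts_while [[]|[_ [t [/IH1 <-]]]] //; apply: IH2.
Qed.

Definition regs_expr (e : expr) : nat := if e is ESum r _ then r.+1 else 0.

Fixpoint regs (c : cmd) : nat :=
  match c with
  | CSkip => 0
  | CSet r e => maxn r.+1 (regs_expr e)
  | CSeq c1 c2 => maxn (regs c1) (regs c2)
  | CWhile r q c => maxn (maxn r.+1 q.+1) (regs c)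
  end.

(* Arguments are read from the registers [ar], the result goes to [o], and
   registers from [b] on are scratch space. Where [f] is undefined the
   program is arbitrary. *)
Fixpoint comp (f : prf) (ar : seq nat) (o b : nat) : cmd :=
  match f with
  | PZero => CSet o EZero
  | PSucc => CSet o (ESum (head 0 ar) true)
  | PProj i => CSet o (ESum (nth 0 ar i) false)
  | PComp f gs =>
      let n := size gs in
      CSeq ((fix comps gs j :=
               match gs with
               | [::] => CSkip
               | g :: gs' => CSeq (comp g ar j (b + n)) (comps gs' j.+1)
               end) gs b)
           (comp f (iota b n) o (b + n))
  | PRec f g =>
      CSeq (comp f (behead ar) o b.+2)
     (CSeq (CSet b EZero)
           (CWhile b (head 0 ar)
              (CSeq (comp g (b :: o :: behead ar) b.+1 b.+2)
              (CSeq (CSet o (ESum b.+1 false)) (CSet b (ESum b true))))))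
  | PMu f =>
      CSeq (CSet o EZero)
     (CSeq (CSet b EZero)
     (CSeq (comp f (o :: ar) b.+1 b.+2)
           (CWhile b.+1 b
              (CSeq (CSet o (ESum o true)) (comp f (o :: ar) b.+1 b.+2)))))
  end.

(** The local fixpoint of [comp] under a name, so that [comps_spec] can speak of it; [b] stands for
    the [b + n] of the case [PComp]. *)
Definition comps (ar : seq nat) (b : nat) : seq prf -> nat -> cmd :=
  fix comps gs j :=
    match gs with
    | [::] => CSkip
    | g :: gs' => CSeq (comp g ar j b) (comps gs' j.+1)
    end.

(** A nested fixpoint runs through the list below [PComp], for which [Q] is the induction
    predicate. *)
Lemma prf_nested_ind (P : prf -> Prop) (Q : seq prf -> Prop) :
  P PZero -> P PSucc -> (forall i, P (PProj i)) ->
  (forall f gs, P f -> Q gs -> P (PComp f gs)) ->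
  (forall f g, P f -> P g -> P (PRec f g)) ->
  (forall f, P f -> P (PMu f)) ->
  Q [::] -> (forall g gs, P g -> Q gs -> Q (g :: gs)) ->
  forall f, P f.
Proof.
move=> H1 H2 H3 H4 H5 H6 Q1 Q2.
exact: (fix F f : P f :=
  match f with
  | PZero => H1 | PSucc => H2 | PProj i => H3 i
  | PComp f gs =>
      H4 f gs (F f) ((fix G gs : Q gs :=
        match gs with [::] => Q1 | g :: gs' => Q2 g gs' (F g) (G gs') end) gs)
  | PRec f g => H5 f g (F f) (F g)
  | PMu f => H6 f (F f)
  end).
Qed.

(** * Correctness of the compilation *)

Lemma updE A (e : nat -> A) x v y : upd e x v y = if y == x then v else e y.
Proof. by []. Qed.

Lemma upd_eq A (e : nat -> A) x v : upd e x v x = v.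
Proof. by rewrite /upd eqxx. Qed.

Lemma upd_neq A (e : nat -> A) x v y : y <> x -> upd e x v y = e y.
Proof. by rewrite /upd; case: eqP. Qed.

(** As [o] is no argument register, a loop may accumulate its result there while its inputs stay
    intact. *)
Definition comp_spec (f : prf) : Prop :=
  forall xs y ar o b (s : store), peval f xs y -> map s ar = xs ->
  (forall r, r \in ar -> r < b /\ r <> o) -> o < b ->
  exists s', [/\ halts_in (comp f ar o b) s s', s' o = y &
                 forall q, q < b -> q <> o -> s' q = s q].

Definition comps_spec (gs : seq prf) : Prop :=
  forall xs ys ar j b (s : store), pevals gs xs ys -> map s ar = xs ->
  (forall r, r \in ar -> r < j) -> j + size gs <= b ->
  exists s', [/\ halts_in (comps ar b gs j) s s',
                 map s' (iota j (size gs)) = ys &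
                 forall q, q < j -> s' q = s q].

Lemma peval_inv f xs y : peval f xs y ->
  match f with
  | PZero => y = 0
  | PSucc => exists x xs', xs = x :: xs' /\ y = x.+1
  | PProj i => i < size xs /\ y = nth 0 xs i
  | PComp f gs => exists2 ys, pevals gs xs ys & peval f ys y
  | PRec f g =>
      match xs with
      | [::] => False
      | 0 :: xs => peval f xs y
      | n.+1 :: xs =>
          exists2 z, peval (PRec f g) (n :: xs) z & peval g (n :: z :: xs) y
      end
  | PMu f => peval f (y :: xs) 0 /\
      forall m, m < y -> exists k, peval f (m :: xs) k.+1
  end.
Proof.
by case=> {f xs y} //=; eauto.
Qed.

Lemma pevals_inv gs xs ys : pevals gs xs ys ->
  match gs with
  | [::] => ys = [::]
  | g :: gs => exists y ys', [/\ ys = y :: ys', peval g xs y & pevals gs xs ys']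
  end.
Proof. by case=> // {gs ys}xs g gs y ys; exists y, ys. Qed.

Lemma comp_rec_correct f g : comp_spec f -> comp_spec g -> comp_spec (PRec f g).
Proof.
move=> IHf IHg xs y [|a ar] o b s Hev Hxs Har Hob.
  by move: Hev => /peval_inv; rewrite -Hxs.
have [Ha Hao] := Har a (mem_head _ _).
have Har' r : r \in ar -> r < b /\ r <> o by move=> H; apply: Har; rewrite in_cons H orbT.
have Far (t : store) : (forall q, q < b -> q <> o -> t q = s q) -> map t ar = map s ar.
  by move=> Ft; apply/eq_in_map => r /Har' [? ?]; apply: Ft.
set c := comp _ _ _ _; set body := CSeq (comp g (b :: o :: ar) b.+1 b.+2)
       (CSeq (CSet o (ESum b.+1 false)) (CSet b (ESum b true))).
(* Induction on the value of the counter [b]. Runs are composed from the front: whatever completes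
   the loop from [t] completes the whole program from [s]. *)
have [t [To Tb Tf Tw]] : exists t : store, [/\ t o = y, t b = s a,
    forall q, q < b -> q <> o -> t q = s q &
    forall s', halts_in (CWhile b a body) t s' -> halts_in c s s'].
  rewrite -Hxs /= in Hev; elim: {-2}(s a) (leqnn (s a)) y Hev => [|n IH] Hn y /peval_inv.
    move=> Hf; have [||s1 [R1 E1 F1]] := IHf _ _ ar o b.+2 s Hf erefl.
    + by move=> r /Har'; lia.
    + by lia.
    exists (upd s1 b 0); split.
    + by rewrite upd_neq //; lia.
    + by rewrite upd_eq.
    + by move=> q ? ?; rewrite upd_neq ?F1 //; lia.
    + move=> s' H; apply/halts_seq; exists s1; split=> //.
      by apply/halts_seq; exists (upd s1 b 0); split=> //; apply/halts_set.
  case=> z /IH [|t [To Tb Tf Tw] Hg]; first by lia.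
  have [|||s1 [R1 E1 F1]] := IHg _ _ (b :: o :: ar) b.+1 b.+2 t Hg.
  + by rewrite /= Tb To Far.
  + by move=> r; rewrite !in_cons => /or3P [/eqP->|/eqP->|/Har']; lia.
  + by lia.
  exists (upd (upd s1 o y) b n.+1); split.
  + by rewrite upd_neq ?upd_eq //; lia.
  + by rewrite upd_eq.
  + by move=> q ? ?; rewrite !upd_neq ?F1 ?Tf //; lia.
  move=> s' H; apply: Tw; apply/halts_while; right; split; first by rewrite Tb Tf //; lia.
  exists (upd (upd s1 o y) b n.+1); split=> //.
  apply/halts_seq; exists s1; split=> //; apply/halts_seq; exists (upd s1 o y).
  split; apply/halts_set => /=; first by rewrite E1 addn0.
  by rewrite upd_neq ?F1 ?Tb ?addn1 //; lia.
by exists t; split=> //; apply: Tw; apply/halts_while; left; rewrite Tb Tf.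
Qed.

Lemma comp_mu_correct f : comp_spec f -> comp_spec (PMu f).
Proof.
move=> IHf xs n ar o b s Hev Hxs Har Hob.
have [Hn Hlt] := peval_inv Hev.
have Far (t : store) : (forall q, q < b -> q <> o -> t q = s q) -> map t ar = xs.
  by rewrite -Hxs => Ft; apply/eq_in_map => r /Har [? ?]; apply: Ft.
set c := comp _ _ _ _; set body := CSeq (CSet o (ESum o true)) (comp f (o :: ar) b.+1 b.+2).
have Hrun m v (t : store) : peval f (m :: xs) v -> t o = m ->
    (forall q, q < b -> q <> o -> t q = s q) ->
    exists s', [/\ halts_in (comp f (o :: ar) b.+1 b.+2) t s', s' b.+1 = v &
                    forall q, q < b.+1 -> s' q = t q].
  move=> Hf To Tf; have [|||s1 [R1 E1 F1]] := IHf _ _ (o :: ar) b.+1 b.+2 t Hf.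
  + by rewrite /= To Far.
  + by move=> r; rewrite in_cons => /orP [/eqP->|/Har]; lia.
  + by lia.
  by exists s1; split=> // q ?; apply: F1; lia.
(* Same scheme: [o] holds the candidate [m], [b] stays 0 and [b.+1] holds the value at [m].
   Candidates below [n] have nonzero values, so the loop goes on up to [n]. *)
have Hloop m v : m <= n -> peval f (m :: xs) v ->
    exists t : store, [/\ t o = m, t b = 0, t b.+1 = v,
    forall q, q < b -> q <> o -> t q = s q &
    forall s', halts_in (CWhile b.+1 b body) t s' -> halts_in c s s'].
  elim: m v => [|m IH] v Hm Hv.
    have [||s1 [R1 E1 F1]] := Hrun 0 v (upd (upd s o 0) b 0) Hv.
    + by rewrite upd_neq ?upd_eq //; lia.
    + by move=> q ? ?; rewrite !upd_neq //; lia.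
    exists s1; split=> //.
    + by rewrite F1 1?upd_neq ?upd_eq //; lia.
    + by rewrite F1 ?upd_eq //; lia.
    + by move=> q ? ?; rewrite F1 ?upd_neq //; lia.
    move=> s' H; apply/halts_seq; exists (upd s o 0); split; first exact/halts_set.
    apply/halts_seq; exists (upd (upd s o 0) b 0); split; first exact/halts_set.
    by apply/halts_seq; exists s1.
  have [k Hk] := Hlt m Hm; have [t [To Tb Tv Tf Tw]] := IH _ (ltnW Hm) Hk.
  have [||s1 [R1 E1 F1]] := Hrun m.+1 v (upd t o m.+1) Hv.
  + by rewrite upd_eq.
  + by move=> q ? ?; rewrite upd_neq ?Tf //; lia.
  exists s1; split=> //.
  + by rewrite F1 ?upd_eq //; lia.
  + by rewrite F1 ?upd_neq ?Tb //; lia.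
  + by move=> q ? ?; rewrite F1 ?upd_neq ?Tf //; lia.
  move=> s' H; apply: Tw; apply/halts_while; right; rewrite Tv Tb; split=> //.
  exists s1; split=> //; apply/halts_seq; exists (upd t o m.+1); split=> //.
  by apply/halts_set; rewrite /= To addn1.
have [t [To Tb Tv Tf Tw]] := Hloop n 0 (leqnn n) Hn.
by exists t; split=> //; apply: Tw; apply/halts_while; left; rewrite Tb Tv.
Qed.

Lemma comp_correct f : comp_spec f.
Proof.
apply: (@prf_nested_ind comp_spec comps_spec) => {f}.
- move=> xs y ar o b s /peval_inv-> _ _ _.
  by exists (upd s o 0); split=> [||q _ N]; rewrite ?upd_eq ?upd_neq //; apply/halts_set.
- move=> xs y [|a ar] o b s /peval_inv [x [xs' [-> ->]]] //= [<- _] _ _.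
  exists (upd s o (s a + true)); split=> [||q _ N];
    rewrite ?upd_eq ?upd_neq //; [exact/halts_set | exact: addn1].
- move=> i xs y ar o b s /peval_inv [Hi ->] E _ _.
  exists (upd s o (s (nth 0 ar i) + false)); split=> [||q _ N];
    rewrite ?upd_eq ?upd_neq //; first exact/halts_set.
  by rewrite addn0 -E (nth_map 0) // -(size_map s) E.
- move=> f gs IHf IHgs xs y ar o b s /peval_inv [ys Hgs Hf] E Har Hob /=.
  have [||s1 [R1 E1 F1]] := IHgs _ _ ar b (b + size gs) s Hgs E.
  + by move=> r /Har [].
  + by [].
  have [||s2 [R2 E2 F2]] := IHf _ _ _ o (b + size gs) s1 Hf E1.
  + by move=> r; rewrite mem_iota; lia.
  + by lia.
  exists s2; split=> //; first by apply/halts_seq; exists s1.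
  by move=> q qb qo; rewrite F2 ?F1 //; lia.
- exact: comp_rec_correct.
- exact: comp_mu_correct.
- move=> xs ys ar j b s /pevals_inv-> _ _ _.
  by exists s; split=> //; exists [::]; constructor.
- move=> g gs IHg IHgs xs ys ar j b s /pevals_inv [y [ys' [-> Hg Hgs]]] E Har /= Hb.
  have [||s1 [R1 E1 F1]] := IHg _ _ ar j b s Hg E.
  + by move=> r /Har; lia.
  + by lia.
  have Es1 : map s1 ar = xs.
    by rewrite -E; apply/eq_in_map => r /Har ?; apply: F1; lia.
  have [||s2 [R2 E2 F2]] := IHgs _ _ ar j.+1 b s1 Hgs Es1.
  + by move=> r /Har; lia.
  + by lia.
  exists s2; split.
  + by apply/halts_seq; exists s1.
  + by rewrite E2 F2 // E1.
  + by move=> q qj; rewrite F2 ?F1 //; lia.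
Qed.

(** * The multitrace formula of a program *)

(** The least fixpoint of the identity is empty. As a successor formula it never holds, so that
    heads move to the immediate successor. *)
Definition TFalse : tf := TMu 0 (TVar 0).
Definition TAnd (d1 d2 : tf) : tf := TNeg (TOr (TNeg d1) (TNeg d2)).
Definition MAnd (m1 m2 : mf) : mf := MNeg (MOr (MNeg m1) (MNeg m2)).

Fixpoint MAll (F : nat -> mf) (n : nat) : mf :=
  if n is n'.+1 then MAnd (F n') (MAll F n') else MNeg (MMu 0 (MVar 0)).

Definition assign (F : nat -> tf) (n : nat) : succ_assign :=
  [seq (p, F p) | p <- iota 0 n].

(* A trace is a sequence of blocks [sep one^x], each coding the number [x]. *)
Definition sep : tf := TAp 0.
Definition one : tf := TNeg sep.

Definition step_one (k : nat) : succ_assign := assign (fun=> TFalse) k.*2.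
Definition step_block (k : nat) : succ_assign := assign (fun=> sep) k.*2.

(** Tested when the block at [p] has ended: exactly [b] more ones remain in the block at [q]. *)
Definition sep_after (b : bool) : tf := if b then TAnd one (TNext Sg sep) else sep.

(* The block at [q] is [b] longer than the block at [p]. *)
Definition eq_block (k d p q : nat) (b : bool) : mf :=
  MMu d (MNext (step_one k)
    (MOr (MAnd (MTest sep p) (MTest (sep_after b) q))
         (MAnd (MTest one p) (MAnd (MTest one q) (MVar d))))).

Definition chk_expr (k d : nat) (e : expr) (q : nat) : mf :=
  match e with
  | EZero => MTest (TNext Sg sep) q.*2.+1
  | ESum r b => eq_block k d r.*2 q.*2.+1 b
  end.

(* Traces [2r] and [2r+1] carry the same word, the history of register [r];
   the head on [2r] is at the current block and the one on [2r+1] at the next.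
   The loops of the program are fixpoints over the variables [>= d]. *)
Fixpoint cmd_mf (k d : nat) (c : cmd) (m : mf) : mf :=
  match c with
  | CSkip => m
  | CSet r e =>
      MAnd (MAll (fun q => chk_expr k d (if q == r then e else ESum q false) q) k)
           (MNext (step_block k) m)
  | CSeq c1 c2 => cmd_mf k d c1 (cmd_mf k d c2 m)
  | CWhile r q c =>
      MMu d (MOr
        (MAnd (eq_block k d.+1 r.*2 q.*2 false) m)
        (MAnd (MNeg (eq_block k d.+1 r.*2 q.*2 false)) (cmd_mf k d.+1 c (MVar d))))
  end.

(** The negation of: some position reached in lockstep shows a disagreement. *)
Definition same_words (k : nat) : mf :=
  MNeg (MMu 0 (MOr
    (MNeg (MAll (fun r => MAnd (MOr (MTest one r.*2) (MTest sep r.*2.+1))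
                               (MOr (MTest sep r.*2) (MTest one r.*2.+1))) k))
    (MNext (step_one k) (MVar 0)))).

Fixpoint hex (n : nat) (h : hf) : hf := if n is n'.+1 then HEx n' (hex n' h) else h.

(** The first move brings even heads to position 1 and odd heads to the first separator; since it
    costs the even heads one position, input [n] is written with [n+2] ones. Trace 2 belongs to
    register 1, the output register. *)
Definition prog_hf (k : nat) (c : cmd) : hf :=
  hex k.*2 (HBase (MAnd (same_words k)
    (MNext (assign (fun p => if odd p then sep else TFalse) k.*2)
           (cmd_mf k 0 c (MTest (TNext Sg sep) 2))))).

(** * Semantics of the program formulas *)

Section Semantics.
Context (Pi : nat -> trace).
Implicit Types (E : nat -> (nat -> nat) -> Prop) (v : nat -> nat).

Lemma msem_and E m1 m2 v : msem Pi E (MAnd m1 m2) v <-> msem Pi E m1 v /\ msem Pi E m2 v.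
Proof. by split=> /=; [move/not_or_and=> [/NNPP ? /NNPP] | tauto]. Qed.

Lemma msem_mu E X m v :
  msem Pi E (MMu X m) v <->
  forall S, (forall u, msem Pi (upd E X S) m u -> S u) -> S v.
Proof. by []. Qed.

Lemma msem_or E m1 m2 v : msem Pi E (MOr m1 m2) v <-> msem Pi E m1 v \/ msem Pi E m2 v.
Proof. by []. Qed.

Lemma msem_all E F n v :
  msem Pi E (MAll F n) v <-> forall r, r < n -> msem Pi E (F r) v.
Proof.
elim: n => [|n IH]; first by split=> // _ /(_ (fun=> False)); apply.
rewrite [MAll _ _]/= msem_and IH; split=> [[H1 H2] r|H].
  by rewrite ltnS leq_eqVlt => /orP [/eqP->|/H2].
by split=> [|r ?]; apply: H; lia.
Qed.

Lemma lookup_assign F n p : lookup (assign F n) p = if p < n then Some (F p) else None.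
Proof.
rewrite /assign -[p < n](mem_iota 0 n p); elim: (iota 0 n) => //= q s IH.
by rewrite in_cons eq_sym; case: eqP => [->|_].
Qed.

Lemma delta_set_assign w F n p i :
  delta_set w (assign F n) p i <-> p < n /\ tsem w tenv0 (F p) i.
Proof. by rewrite /delta_set lookup_assign; case: ltnP => H; split=> // -[]. Qed.

Lemma tsem_false w e i : ~ tsem w e TFalse i.
Proof. by move/(_ (fun=> False)); apply. Qed.

(** The head at [i] stands just before the [x] ones, usually on the separator that opens the block;
    the next separator closes it. *)
Definition block (w : trace) (i x : nat) : Prop :=
  (forall j, j < x -> ~ tlab w (i + j).+1 0) /\ tlab w (i + x).+1 0.

Lemma block0 w i : block w i 0 <-> tlab w i.+1 0.
Proof. by rewrite /block addn0; split=> // -[]. Qed.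

Lemma blockS w i x : block w i x.+1 <-> ~ tlab w i.+1 0 /\ block w i.+1 x.
Proof.
rewrite /block addSnnS; split=> [[H1 H2]|[H1 [H2 H3]]].
  split; first by rewrite -[i]addn0; apply: H1.
  by split=> // j Hj; rewrite addSnnS; apply: H1.
by split=> // -[|j] Hj; rewrite ?addn0 // -addSnnS; apply: H2.
Qed.

Lemma block_uniq w i x y : block w i x -> block w i y -> x = y.
Proof.
elim: x y i => [|x IH] [|y] i //.
- by move=> /block0 ? /blockS [].
- by move=> /blockS [? _] /block0.
- by move=> /blockS [_ Hx] /blockS [_ Hy]; congr _.+1; apply: IH Hx Hy.
Qed.

Lemma adv_block w (D : nat -> Prop) i j x : (forall l, D l <-> tlab w l 0) ->
  block w i x -> adv D i j <-> j = (i + x).+1.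
Proof.
move=> HD [Hx1 Hx2].
have Hlt l : i < l < (i + x).+1 -> ~ D l.
  move=> Hl /HD; have -> : l = (i + (l - i.+1)).+1 by lia.
  by apply: Hx1; lia.
split=> [[[Hij [/HD Hj Hk]]|[_ Hk]]|->].
- case: (ltngtP j (i + x).+1) => // H; first by case: (Hlt j); [lia | apply/HD].
  by case: (Hk (i + x).+1); [lia | apply/HD].
- by case: (Hk (i + x).+1); [lia | apply/HD].
- by left; split; [lia | split=> //; apply/HD].
Qed.

Lemma adv_never (D : nat -> Prop) i j : (forall l, ~ D l) -> adv D i j <-> j = i.+1.
Proof.
move=> HD; split=> [[[_ [/HD]]|[]] //|->].
by right; split=> // l _; apply: HD.
Qed.

Lemma adv_step_one k p i j : adv (delta_set (Pi p) (step_one k) p) i j <-> j = i.+1.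
Proof. by apply: adv_never => l /delta_set_assign [_ /tsem_false]. Qed.

Lemma adv_step_block k p i j x : p < k.*2 -> block (Pi p) i x ->
  adv (delta_set (Pi p) (step_block k) p) i j <-> j = (i + x).+1.
Proof.
by move=> Hp; apply: adv_block => l; rewrite delta_set_assign; split=> // -[].
Qed.

Lemma msem_step_one E k m v :
  msem Pi E (MNext (step_one k) m) v <->
  exists v', (forall p, v' p = (v p).+1) /\ msem Pi E m v'.
Proof.
by split=> -[v' [H1 H2]]; exists v'; split=> // p; apply/(adv_step_one k p).
Qed.

Lemma tsem_sep_after w b i : tsem w tenv0 (sep_after b) i.+1 <-> block w i b.
Proof.
case: b; last by rewrite block0.
rewrite (blockS _ _ 0) block0 /=; split=> [/not_or_and [/NNPP H1 /NNPP [j [-> H2]]] //|].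
by move=> [H1 H2] [//|]; apply; exists i.+2.
Qed.

Lemma msem_eq_block E k d p q b v x : block (Pi p) (v p) x ->
  msem Pi E (eq_block k d p q b) v <-> block (Pi q) (v q) (x + b).
Proof.
move=> Hx; split=> [H|Hy]; last (apply/msem_mu => S HS).
(* The claim itself, for all lengths [x], is taken as the pre-fixed point. *)
- move: x Hx; apply: (iffLR (msem_mu _ _ _ _) H (fun u => forall x, block (Pi p) (u p) x -> block (Pi q) (u q) (x + b))).
  move=> u /msem_step_one [v' [Hv' Hm]] x Hx.
  case/msem_or: Hm => [/msem_and [Hp]|/msem_and [Hp /msem_and [Hq]]].
  + rewrite /= Hv' in Hp; rewrite /= Hv' => /tsem_sep_after Hq.
    by rewrite (block_uniq Hx (y := 0)) //; apply/block0.
  + rewrite /= Hv' in Hp; rewrite /= Hv' in Hq.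
    case: x Hx => [/block0 //|x /blockS [_ Hx]].
    rewrite /= upd_eq => /(_ x); rewrite !Hv' => /(_ Hx) Hy.
    by apply/blockS.
- elim: x v Hx Hy => [|x IH] v Hx Hy; apply: HS; apply/msem_step_one;
    exists (fun p => (v p).+1); split=> //.
  + apply/msem_or; left; apply/msem_and; split; first exact/block0.
    exact/tsem_sep_after.
  + move/blockS: Hx => [Hx1 Hx2]; move/blockS: Hy => [Hy1 Hy2].
    apply/msem_or; right; apply/msem_and; split=> //; apply/msem_and; split=> //.
    by rewrite /= upd_eq; apply: IH.
Qed.

Lemma msem_chk_expr E k d e q v (s : store) :
  (forall r b, e = ESum r b -> block (Pi r.*2) (v r.*2) (s r)) ->
  msem Pi E (chk_expr k d e q) v <-> block (Pi q.*2.+1) (v q.*2.+1) (eval e s).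
Proof.
case: e => [_|r b /(_ _ _ erefl) H] /=; last exact: msem_eq_block.
rewrite block0; split=> [[j [-> //]]|H]; by exists (v q.*2.+1).+1.
Qed.

(** The odd head stands on the separator closing the current block; the next block, to be checked
    against the next store, is left open. *)
Definition conf (k : nat) (v : nat -> nat) (s : store) : Prop :=
  forall r, r < k -> block (Pi r.*2) (v r.*2) (s r) /\
                     v r.*2.+1 = (v r.*2 + s r).+1.

Definition agree (d : nat) (E E' : nat -> (nat -> nat) -> Prop) : Prop :=
  forall X, X < d -> E' X = E X.

Context (k : nat).
Hypothesis same : forall r i, r < k -> tlab (Pi r.*2) i 0 <-> tlab (Pi r.*2.+1) i 0.

Lemma same_block r i x : r < k -> block (Pi r.*2) i x <-> block (Pi r.*2.+1) i x.
Proof.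
move=> Hr; split=> -[H1 H2]; split.
- by move=> j /H1; rewrite same.
- exact/same.
- by move=> j /H1; rewrite -same.
- exact/same.
Qed.

Lemma odd_half_cases p : p < k.*2 -> exists2 r, r < k & p = r.*2 \/ p = r.*2.+1.
Proof. by exists p./2; lia. Qed.

(** The even head lands where the odd head was, and by [same] it finds there the block that the odd
    head had before it. *)
Lemma conf_step v v' s s' : conf k v s ->
  (forall r, r < k -> block (Pi r.*2.+1) (v r.*2.+1) (s' r)) ->
  (forall p, p < k.*2 -> adv (delta_set (Pi p) (step_block k) p) (v p) (v' p)) ->
  conf k v' s'.
Proof.
move=> Hc Hb Ha r Hr; have [Hs Hv] := Hc r Hr; have Hb' := Hb r Hr.
have H1 := Ha r.*2; rewrite (adv_step_block _ _ Hs) in H1; last by lia.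
have H2 := Ha r.*2.+1; rewrite (adv_step_block _ _ Hb') in H2; last by lia.
rewrite H1 ?H2; [|lia..].
by rewrite -Hv; split=> //; apply/same_block.
Qed.

(** The formula [m] is a continuation and is reached inside the fixpoints of the loops passed, hence
    in an environment [E'] that may differ from [E] from [d] on. For a loop body this keeps the
    meaning of [MVar d]. *)
Lemma cmd_mf_sound c d m E v s : regs c <= k -> conf k v s ->
  msem Pi E (cmd_mf k d c m) v ->
  exists s' v' E', [/\ halts_in c s s', conf k v' s', agree d E E' & msem Pi E' m v'].
Proof.
elim: c d m E v s => [|r e|c1 IH1 c2 IH2|r q c IH] d m E v s Hk Hc;
  rewrite [cmd_mf _ _ _ _]/= => Hm; rewrite /= in Hk.
- by exists s, v, E; split=> //; exists [::]; constructor.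
- move/msem_and: Hm => [/msem_all Hq [v' [Ha Hm]]].
  exists (upd s r (eval e s)), v', E; split=> //; first exact/halts_set.
  apply: (conf_step Hc) => // q Hqk.
  move/msem_chk_expr: (Hq q Hqk) => /(_ s) H; rewrite updE.
  case: eqP H => [->|_] H; last by rewrite -[s q]addn0; apply: H => ? ? [<- _]; case: (Hc q).
  apply: H => r' b Ee; case: (Hc r') => //.
  by move: Hk; rewrite Ee /=; lia.
- have [|s1 [v1 [E1 [R1 C1 A1 M1]]]] := IH1 _ _ _ _ _ _ Hc Hm; first by lia.
  have [|s2 [v2 [E2 [R2 C2 A2 M2]]]] := IH2 _ _ _ _ _ _ C1 M1; first by lia.
  exists s2, v2, E2; split=> //; first by apply/halts_seq; exists s1.
  by move=> X HX; rewrite A2 ?A1.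
(* Soundness of the loop itself, for all stores, serves as the pre-fixed point; the least fixpoint
   thus excludes infinite runs. *)
- move: s Hc; pose S u := forall s, conf k u s ->
    exists s' v' E', [/\ halts_in (CWhile r q c) s s', conf k v' s', agree d E E' &
                        msem Pi E' m v'].
  apply: (iffLR (msem_mu _ _ _ _) Hm S) => u Hu s Hc.
  have [Hcr _] : block (Pi r.*2) (u r.*2) (s r) /\ _ := Hc r ltac:(lia).
  have [Hcq _] : block (Pi q.*2) (u q.*2) (s q) /\ _ := Hc q ltac:(lia).
  case/msem_or: Hu => /msem_and [].
  + move=> /(msem_eq_block _ _ _ _ _ Hcr) Hq Hm'; rewrite addn0 in Hq.
    exists s, u, (upd E d S); split=> //.
    * by apply/halts_while; left; split=> //; apply: block_uniq Hq Hcq.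
    * by move=> X HX; rewrite upd_neq //; lia.
  + move=> Hn Hm'; have Nrq : s r <> s q.
      move=> Erq; apply: Hn; apply/(msem_eq_block _ _ _ _ _ Hcr).
      by rewrite addn0 Erq.
    have [|s1 [v1 [E1 [R1 C1 A1 /=]]]] := IH _ _ _ _ _ _ Hc Hm'; first by lia.
    rewrite (A1 d) // upd_eq => /(_ _ C1) [s2 [v2 [E2 [R2 C2 A2 M2]]]].
    exists s2, v2, E2; split=> //.
    by apply/halts_while; right; split=> //; exists s1.
Qed.

Fixpoint future (l : seq store) (r i : nat) : Prop :=
  if l is s :: l' then block (Pi r.*2.+1) i (s r) /\ future l' r (i + s r).+1
  else True.

(** Induction on the finite run. The traces spell the stores [l] of this command, then those in
    [post], which are left to the continuation [m]. *)
Lemma cmd_mf_complete c d m E v s l s' post :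
  exec c s l s' -> regs c <= k -> conf k v s ->
  (forall r, r < k -> future (l ++ post) r (v r.*2.+1)) ->
  (forall E' v', agree d E E' -> conf k v' s' ->
     (forall r, r < k -> future post r (v' r.*2.+1)) -> msem Pi E' m v') ->
  msem Pi E (cmd_mf k d c m) v.
Proof.
move=> H; elim: H d m E v post => {c s l s'}.
- by move=> s d m E v post _ Hc Hf; apply.
- move=> r e s s' d m E v post Hk Hc Hf Hm;
  rewrite [cmd_mf _ _ _ _]/=; rewrite /= in Hk.
  have Hb q : q < k -> block (Pi q.*2.+1) (v q.*2.+1) (s' q) by move=> /Hf [].
  apply/msem_and; split.
    apply/msem_all => q Hq; apply/(msem_chk_expr _ _ _ _ (s := s)).
      move=> r' b; case: eqP => [_ Ee|_ [<- _]]; last by case: (Hc q).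
      by case: (Hc r') => //; move: Hk; rewrite Ee /=; lia.
    by have := Hb q Hq; rewrite /s' updE; case: eqP => // _; rewrite /= addn0.
  (* Odd heads jump over the new value and even heads over the old one; traces outside the
     assignment have an empty successor set and advance by one. *)
  pose v' p := if p < k.*2 then
    if odd p then (v p + s' p./2).+1 else (v p + s p./2).+1 else (v p).+1.
  have Hv' p : adv (delta_set (Pi p) (step_block k) p) (v p) (v' p).
    rewrite /v'; case: ifP => Hp.
      have [r' Hr' [->|->]] := odd_half_cases Hp.
        rewrite odd_double doubleK; apply/adv_step_block; [by lia| |by []].
        by case: (Hc r').
      rewrite oddS odd_double /= uphalf_double.
      by apply/adv_step_block; [lia|apply: Hb|].
    by apply/adv_never => // l /delta_set_assign [H _]; move: Hp; rewrite H.
  exists v'; split=> //; apply: Hm => //; first exact: (conf_step Hc).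
  move=> r' Hr'; have [_] := Hf _ Hr'; rewrite /v'.
  by rewrite ltn_Sdouble Hr' oddS odd_double /= uphalf_double.
- move=> c1 c2 s l1 s1 l2 s2 _ IH1 _ IH2 d m E v post Hk Hc Hf Hm;
  rewrite [cmd_mf _ _ _ _]/=; rewrite /= in Hk.
  apply: (IH1 _ _ _ _ (l2 ++ post)) => //; [by lia|by rewrite catA|].
  move=> E1 v1 A1 C1 F1; apply: (IH2 _ _ _ _ post) => //; first by lia.
  by move=> E2 v2 A2 C2 F2; apply: Hm => // X HX; rewrite A2 ?A1.
- move=> r q c s Eq d m E v post Hk Hc Hf Hm;
  rewrite [cmd_mf _ _ _ _]/=; rewrite /= in Hk; apply/msem_mu => S HS; apply: HS; apply/msem_or; left.
  have [Hcr _] : block (Pi r.*2) (v r.*2) (s r) /\ _ := Hc r ltac:(lia).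
  have [Hcq _] : block (Pi q.*2) (v q.*2) (s q) /\ _ := Hc q ltac:(lia).
  apply/msem_and; split; first by apply/(msem_eq_block _ _ _ _ _ Hcr); rewrite addn0 Eq.
  by apply: Hm => // X HX; rewrite upd_neq //; lia.
- move=> r q c s l1 s1 l2 s2 N _ IH1 _ IH2 d m E v post Hk Hc Hf Hm;
  rewrite [cmd_mf _ _ _ _]/=; rewrite /= in Hk; apply/msem_mu => S HS.
  have [Hcr _] : block (Pi r.*2) (v r.*2) (s r) /\ _ := Hc r ltac:(lia).
  have [Hcq _] : block (Pi q.*2) (v q.*2) (s q) /\ _ := Hc q ltac:(lia).
  apply: (HS); apply/msem_or; right; apply/msem_and; split.
    move=> /(msem_eq_block _ _ _ _ _ Hcr); rewrite addn0 => H.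
    by apply: N; apply: block_uniq H Hcq.
  apply: (IH1 _ _ _ _ (l2 ++ post)) => //; [by lia|by rewrite catA|].
  move=> E1 v1 A1 C1 F1 /=; rewrite (A1 d) // upd_eq.
  (* The remaining run puts [v1] into the least fixpoint, hence into the arbitrary pre-fixed point
     [S]. *)
  have Hw : msem Pi E (cmd_mf k d (CWhile r q c) m) v1 by apply: (IH2 _ _ _ _ post).
  exact: Hw HS.
Qed.

End Semantics.

(** * Correctness of the reduction *)

Lemma msem_same_words Pi k :
  msem Pi menv0 (same_words k) (fun=> 0) <->
  forall r i, r < k -> tlab (Pi r.*2) i 0 <-> tlab (Pi r.*2.+1) i 0.
Proof.
rewrite /same_words; set body := MAll _ k; set loop := MMu _ _.
rewrite -[msem _ _ _ _]/(~ msem Pi menv0 loop (fun=> 0)).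
have Hbody E v : msem Pi E body v <-> forall r, r < k ->
    (tlab (Pi r.*2) (v r.*2) 0 <-> tlab (Pi r.*2.+1) (v r.*2.+1) 0).
  rewrite msem_all; split=> H r Hr; have := H r Hr.
    by case/msem_and; rewrite !msem_or /=; tauto.
  move=> Heq; apply/msem_and; split; apply/msem_or => /=; first by tauto.
  by case: (classic (tlab (Pi r.*2) (v r.*2) 0)); tauto.
split=> [H r i Hr|Heq H].
- apply: NNPP => N; apply: H; apply/msem_mu => S HS.
  (* [j] is the distance from the common position [l] of the heads to the disagreement at [i]. *)
  suff: forall j l, l + j = i -> S (fun=> l) by apply.
  elim=> [|j IH] l Hl; apply: (HS); apply/msem_or.
    by left=> /Hbody /(_ r Hr); rewrite -(addn0 l) Hl.
  right; apply/msem_step_one; exists (fun=> l.+1); split=> //=.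
  by rewrite upd_eq; apply: IH; rewrite addSnnS.
(* The valuations not in lockstep form a pre-fixed point, since lockstep is kept by each step and
   shows no disagreement; the initial valuation is not among them. *)
- move/msem_mu: H => /(_ (fun u => ~ exists n, forall p, u p = n)); apply; last by exists 0.
  move=> u /msem_or [H [n Hu]|/msem_step_one [v' [Hv' H]] [n Hu]].
    by apply: H; apply/Hbody => r Hr; rewrite !Hu; apply: Heq.
  by rewrite /= upd_eq in H; apply: H; exists n.+1 => p; rewrite Hv' Hu.
Qed.

Lemma hsat_base T Pi m : hsat T Pi (HBase m) <-> msem Pi menv0 m (fun=> 0).
Proof. by []. Qed.

Lemma hsat_hex T n h Pi : hsat T Pi (hex n h) ->
  exists Pi', [/\ forall p, p < n -> T (Pi' p), forall p, n <= p -> Pi' p = Pi p &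
                  hsat T Pi' h].
Proof.
elim: n Pi => [|n IH] Pi /=; first by exists Pi.
move=> [t [Ht /IH [Pi' [H1 H2 H3]]]]; exists Pi'; split=> // p Hp.
- move: Hp; rewrite ltnS leq_eqVlt => /orP [/eqP->|/H1 //].
  by rewrite H2 // upd_eq.
- by rewrite H2 ?upd_neq //; lia.
Qed.

(** The final assignment is described pointwise, which avoids comparing iterated updates as
    functions. *)
Lemma hex_hsat T ts n h Pi : (forall p, p < n -> T (ts p)) ->
  (forall Pi', (forall p, p < n -> Pi' p = ts p) ->
               (forall p, n <= p -> Pi' p = Pi p) -> hsat T Pi' h) ->
  hsat T Pi (hex n h).
Proof.
elim: n Pi => [|n IH] Pi HT H /=; first exact: H.
exists (ts n); split; first exact: HT.
apply: IH => [p Hp|Pi' H1 H2]; first by apply: HT; lia.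
apply: H => p Hp.
- move: Hp; rewrite ltnS leq_eqVlt => /orP [/eqP->|/H1 //].
  by rewrite H2 // upd_eq.
- by rewrite H2 ?upd_neq //; lia.
Qed.

(* States 0 and 1 generate all words over {sep, one}; the chain
   n+3 -> n+2 -> .. -> 2 -> 0 in front of them forces every trace to begin
   with n+2 times one, followed by sep. *)
Fixpoint input_edges (n : nat) : seq (nat * nat) :=
  if n is n'.+1 then (n.+3, n.+2) :: input_edges n'
  else [:: (0, 0); (0, 1); (1, 0); (1, 1); (2, 0); (3, 2)].

Definition input_kripke (n : nat) : kripke :=
  Kripke n.+4 [:: n.+3] (input_edges n) [:: [:: 0]].

Lemma mem_input_edges n x y : (x, y) \in input_edges n =
  [|| (x <= 1) && (y <= 1), (x == 2) && (y == 0) | (2 < x <= n.+3) && (x == y.+1)].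
Proof.
elim: n => [|n IH] /=; last by rewrite in_cons IH xpair_eqE; lia.
by rewrite !in_cons in_nil !xpair_eqE; lia.
Qed.

Lemma input_kripke_wf n : kripke_wf (input_kripke n).
Proof.
move=> s /= Hs; exists (if s <= 2 then 0 else s.-1).
by split; [|rewrite mem_input_edges]; case: ifP; lia.
Qed.

(** By the default [[::]] only state 0 carries a label: it emits [sep], all others emit [one]. *)
Lemma mem_label a s : (a \in nth [::] [:: [:: 0]] s) = (a == 0) && (s == 0).
Proof. by case: s => [|[|s]]; rewrite /= ?inE ?andbT ?andbF. Qed.

(** Positions 1 to [n+1] run through the states [n+2] down to 2, and position [n+2] is in state
    0. *)
Lemma Traces_block n w : Traces (input_kripke n) w -> block w 0 n.+1.
Proof.
move=> [p [Hp0 Hp Hl _]]; rewrite /= inE in Hp0.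
have Hpi i : i <= n.+1 -> p i = n.+3 - i.
  elim: i => [_|i IH Hi]; first by rewrite (eqP Hp0).
  have [_] := Hp i; rewrite mem_input_edges IH; lia.
have [_] := Hp n.+1; rewrite mem_input_edges Hpi // => Hend.
split=> [j Hj|]; last by apply/Hl; rewrite add0n mem_label; lia.
by rewrite add0n Hl mem_label Hpi //; lia.
Qed.

Definition word_trace (g : nat -> bool) : trace :=
  Trace (fun i a => a = 0 /\ ~~ g i) (fun=> PInt).

Lemma word_trace_Traces n (g : nat -> bool) : (forall i, i < n.+2 -> g i) -> ~~ g n.+2 ->
  Traces (input_kripke n) (word_trace g).
Proof.
(* After the chain, the bit [g i] read as a number is the state. *)
move=> Hg Hn; exists (fun i => if i < n.+2 then n.+3 - i else g i); split=> //=.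
- by rewrite inE subn0.
- move=> i; rewrite mem_input_edges; split; first by case: ifP; case: (g i); lia.
  case: (ltngtP i n.+1) => Hi.
  + by have [-> ->] : i < n.+2 /\ i.+1 < n.+2; lia.
  + have [-> ->] : (i < n.+2) = false /\ (i.+1 < n.+2) = false by lia.
    by case: (g i); case: (g i.+1).
  + by rewrite Hi ltnSn ltnn (negbTE Hn); lia.
- move=> i a; rewrite mem_label; case: ifP => Hi.
    by rewrite Hg //; lia.
  by case: (g i); lia.
Qed.

(** The last block is left unclosed: with default [false], [nth] continues the word by
    separators. *)
Definition history (n : nat) (l : seq store) (r : nat) : seq bool :=
  nseq n.+2 true ++ flatten [seq false :: nseq (s r) true | s <- l].

Lemma future_history Pi l r A :
  (forall i, tlab (Pi r.*2.+1) i 0 <->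
     ~~ nth false (A ++ flatten [seq false :: nseq (s r) true | s <- l]) i) ->
  future Pi l r (size A).
Proof.
elim: l A => //= s l IH A HA; set B := flatten _ in HA.
have HB : nth false B 0 = false by rewrite /B; case: (l).
split; last first.
  have -> : (size A + s r).+1 = size (A ++ false :: nseq (s r) true).
    by rewrite size_cat /= size_nseq addnS.
  by apply: IH => i; rewrite HA -catA.
split=> [j Hj|].
  rewrite HA nth_cat ltnNge leqW ?leq_addr //= -addnS addKn /=.
  by rewrite nth_cat size_nseq Hj nth_nseq Hj.
rewrite HA nth_cat ltnNge leqW ?leq_addr //= -addnS addKn /=.
by rewrite nth_cat size_nseq ltnn subnn HB.
Qed.

Lemma models_prog_hf k c n : regs c <= k -> 1 < k ->
  models (Traces (input_kripke n)) (prog_hf k c) <->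
  exists2 s', halts_in c (fun=> n) s' & s' 1 = 0.
Proof.
move=> Hc Hk; split.
- move=> /hsat_hex [Pi [HT _ /hsat_base /msem_and [/msem_same_words Hs [v [Hv Hm]]]]].
  have Hconf : conf Pi k v (fun=> n).
    move=> r Hr; have [Hr1 Hr2] : r.*2 < k.*2 /\ r.*2.+1 < k.*2 by lia.
    have /blockS [_ H1] := Traces_block (HT _ Hr1).
    have H2 := Traces_block (HT _ Hr2).
    have /(adv_block _ _ H2) -> := Hv r.*2.+1; last first.
      move=> l; rewrite delta_set_assign oddS odd_double /=.
      by split=> // -[].
    have /adv_never -> // := Hv r.*2.
    by move=> l /delta_set_assign [_]; rewrite odd_double => /tsem_false.
  have [s' [v' [E' [Hx C' _ M']]]] := cmd_mf_sound Hs Hc Hconf Hm.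
  exists s' => //; have [Hb _] := C' 1 Hk.
  by apply: block_uniq Hb _; apply/block0; case: M' => j [->].
- move=> [s' [l Hl] Hs'].
  (* The halving gives both traces of a register the same history. *)
  pose ts p := word_trace (nth false (history n l p./2)).
  have Hts p : Traces (input_kripke n) (ts p).
    apply: word_trace_Traces => [i Hi|]; rewrite nth_cat size_nseq.
      by rewrite Hi nth_nseq Hi.
    by rewrite ltnn subnn; case: (l).
  apply: (hex_hsat (ts := ts)) => [p _|Pi HPi _]; first exact: Hts.
  have HT p : p < k.*2 -> Traces (input_kripke n) (Pi p) by move=> /HPi ->.
  have Hs r i : r < k -> tlab (Pi r.*2) i 0 <-> tlab (Pi r.*2.+1) i 0.
    by move=> Hr; rewrite !HPi ?/ts /= ?uphalf_double ?doubleK //; lia.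
  apply/hsat_base/msem_and; split; first exact/msem_same_words.
  pose v p := if (p < k.*2) && odd p then n.+2 else 1.
  have Hconf : conf Pi k v (fun=> n).
    move=> r Hr; rewrite /v oddS odd_double andbF /= ltn_Sdouble Hr; split=> //.
    by have /blockS [] := Traces_block (HT r.*2 ltac:(lia)).
  exists v; split.
    move=> p; rewrite /v; case: ifP => [/andP [Hp Ho]|Hp].
      apply/(adv_block _ _ (Traces_block (HT _ Hp))) => // i.
      by rewrite delta_set_assign Ho; split=> // -[].
    apply/adv_never => // i /delta_set_assign [Hp']; move: Hp; rewrite Hp' /= => ->.
    exact: tsem_false.
  apply: (cmd_mf_complete (post := [::]) Hs Hl Hc Hconf) => [r Hr|E' v' _ C' _].
    rewrite cats0 /v oddS odd_double ltn_Sdouble Hr /=.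
    have -> : n.+2 = size (nseq n.+2 true) by rewrite size_nseq.
    apply: future_history => i; rewrite HPi; last by lia.
    by rewrite /ts /= uphalf_double; split=> // -[].
  have [Hb _] := C' 1 Hk; exists (v' 2).+1; split=> //.
  by rewrite Hs' in Hb; apply: (iffLR (block0 _ _) Hb).
Qed.

(** * Polarity and well-formedness of the formula *)

Lemma mpolar_all X b F n : (forall r, mpolar X b (F r)) -> mpolar X b (MAll F n).
Proof. by move=> H; elim: n => [|n IH] /=; [case: eqP | rewrite negbK H]. Qed.

(** The only variable in it is bound, so both polarities hold; this admits the negated guard of a
    loop. *)
Lemma mpolar_eq_block X b k d p q e : mpolar X b (eq_block k d p q e).
Proof. by rewrite /=; case: eqP. Qed.

Lemma mpolar_cmd_mf X b k d c m : mpolar X b m -> mpolar X b (cmd_mf k d c m).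
Proof.
elim: c d m => [|r e|c1 IH1 c2 IH2|r q c IH] d m Hm //.
- rewrite /= !negbK Hm andbT; apply: mpolar_all => p.
  by case: (if _ then _ else _) => [|r' b'] //; apply: mpolar_eq_block.
- by apply: IH1; apply: IH2.
- rewrite [cmd_mf _ _ _ _]/=.
  have H d' : mpolar X b (eq_block k d' r.*2 q.*2 false) by exact: mpolar_eq_block.
  have H' d' : mpolar X (~~ b) (eq_block k d' r.*2 q.*2 false) by exact: mpolar_eq_block.
  move: (eq_block _ _ _ _ _) (H d.+1) (H' d.+1) => f Hf Hf' /=.
  case: eqP => //= N; rewrite !negbK Hf Hf' Hm /=.
  by apply: IH; rewrite /=; case: eqP.
Qed.

Lemma assign_wf P F n : (forall p, (p \in P) = (p < n)) ->
  (forall p, tf_closed (F p)) ->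
  all (fun p => isSome (lookup (assign F n) p)) P &&
  all (fun q => tf_closed q.2) (assign F n).
Proof.
move=> HP HF; rewrite /assign all_map; apply/andP; split; apply/allP => p //=.
by rewrite HP lookup_assign => ->.
Qed.

Section WellFormed.
Context (P : seq nat) (k : nat).
Hypothesis HP : forall p, (p \in P) = (p < k.*2).

Lemma mf_wf_all B F n : (forall r, r < n -> mf_wf P B (F r)) -> mf_wf P B (MAll F n).
Proof.
elim: n => [|n IH] H /=; first by rewrite mem_head.
by rewrite H // IH // => r ?; apply: H; lia.
Qed.

Lemma mf_wf_eq_block B d p q b : p < k.*2 -> q < k.*2 -> mf_wf P B (eq_block k d p q b).
Proof.
move=> Hp Hq; rewrite /= eqxx !HP Hp Hq mem_head !andbT /=.
by rewrite assign_wf //; case: b.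
Qed.

(** The continuation ends up under binders of variables from [d] on, whence its polarity in these
    and the larger contexts [B']. *)
Lemma mf_wf_cmd_mf (B : seq nat) d c m : regs c <= k ->
  (forall X, d <= X -> mpolar X true m) ->
  (forall B' : seq nat, {subset B <= B'} -> mf_wf P B' m) ->
  forall B' : seq nat, {subset B <= B'} -> mf_wf P B' (cmd_mf k d c m).
Proof.
elim: c B d m => [|r e|c1 IH1 c2 IH2|r q c IH] B d m Hc Hpol Hm B' HB'.
- exact: Hm.
- rewrite [cmd_mf _ _ _ _]/= [mf_wf _ _ _]/=; apply/andP; split.
    apply: mf_wf_all => p Hp; move: Hc; rewrite /=.
    case: eqP => [->|_]; last by move=> _; apply: mf_wf_eq_block; lia.
    by case: (e) => [|r' b] /= Hr'; [rewrite HP; lia | apply: mf_wf_eq_block; lia].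
  by rewrite Hm // andbT; apply: assign_wf.
- move: Hc; rewrite /= geq_max => /andP [Hc1 Hc2].
  apply: (IH1 B) => // [X HX|B'' HB'']; first by apply: mpolar_cmd_mf; apply: Hpol.
  exact: (IH2 B).
- rewrite [cmd_mf _ _ _ _]/=; rewrite /= in Hc.
  have Hpe X b : mpolar X b (eq_block k d.+1 r.*2 q.*2 false) by exact: mpolar_eq_block.
  have We B1 : mf_wf P B1 (eq_block k d.+1 r.*2 q.*2 false) by apply: mf_wf_eq_block; lia.
  move: (eq_block _ _ _ _ _) Hpe We => f Hf Wf /=.
  rewrite !Hf !Wf Hpol //= mpolar_cmd_mf /=; last by rewrite eqxx.
  rewrite Hm => [|x /HB' Hx]; last by rewrite in_cons Hx orbT.
  apply: (IH [:: d]) => [||B1|x] //=; first by lia.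
  + by move=> X HX; case: eqP => // E; lia.
  + by apply; rewrite mem_head.
  + by rewrite !in_cons => /orP [->|].
Qed.

End WellFormed.

Lemma hf_wf_hex P m n :
  (forall P', (forall p, (p \in P') = (p \in P) || (p < n)) -> mf_wf P' [::] m) ->
  hf_wf P (hex n (HBase m)).
Proof.
elim: n P => [|n IH] P H /=; first by apply: H => p; rewrite orbF.
by apply: IH => P' HP'; apply: H => p; rewrite HP' in_cons ltnS (leq_eqVlt p n) [RHS]orbCA orbA.
Qed.

Lemma prog_hf_closed k c : regs c <= k -> 1 < k -> hf_closed (prog_hf k c).
Proof.
move=> Hc Hk; apply: hf_wf_hex => P /= HP; apply/andP; split.
  apply/andP; split; last (apply/andP; split).
  + by rewrite andbT; apply: mpolar_all.
  + apply: mf_wf_all => r Hr /=; rewrite !HP; lia.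
  + by rewrite assign_wf.
apply/andP; split; first by apply: assign_wf => // p; case: ifP.
by apply: (mf_wf_cmd_mf HP (B := [::])) => // B _ /=; rewrite HP; lia.
Qed.

(** * The encoding of instances *)

Lemma cpairE x y : cpair x y = 'C((x + y).+1, 2) + y.
Proof. by rewrite /cpair bin2 divn2 mulnC. Qed.

Lemma cpair_inj x y x' y' : cpair x y = cpair x' y' -> x = x' /\ y = y'.
Proof.
rewrite !cpairE => H.
(* A code with sum [s] stays below the next triangular number, so the code determines the sum. *)
have Hlt s t u : s < t -> u <= s -> 'C(s.+1, 2) + u < 'C(t.+1, 2).
  move=> Hst Hu; apply: leq_trans (leq_bin2l 2 (_ : s.+2 <= t.+1)) => //.
  by rewrite (binS s.+1) bin1; lia.
case: (ltngtP (x + y) (x' + y')) => [/Hlt /(_ (leq_addl _ _))|/Hlt /(_ (leq_addl _ _))|E].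
- by lia.
- by lia.
- by move: H; rewrite E; lia.
Qed.

Lemma enc_list_inj A (g : A -> nat) : injective g -> injective (enc_list g).
Proof.
move=> Hg; elim=> [|x s IH] [|y t] //.
by move=> [/cpair_inj [/Hg -> /IH ->]].
Qed.

Lemma enc_sk_inj : injective enc_sk.
Proof. by case=> -[]. Qed.

Lemma enc_tf_inj : injective enc_tf.
Proof.
elim=> [a|Y|d1 IH1 d2 IH2|d IH|f d IH|Y d IH] [b|Z|e1 e2|e|g e|Z e] /cpair_inj [] //.
- by move=> _ ->.
- by move=> _ ->.
- by move=> _ /cpair_inj [/IH1 -> /IH2 ->].
- by move=> _ /IH ->.
- by move=> _ /cpair_inj [/enc_sk_inj -> /IH ->].
- by move=> _ /cpair_inj [-> /IH ->].
Qed.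

Lemma enc_sa_inj : injective enc_sa.
Proof.
by apply: enc_list_inj => -[p d] [q e] /cpair_inj [/= -> /enc_tf_inj ->].
Qed.

Lemma enc_mf_inj : injective enc_mf.
Proof.
elim=> [d p|X|m1 IH1 m2 IH2|m IH|D m IH|X m IH] [e q|Z|n1 n2|n|D' n|Z n] /cpair_inj [] //.
- by move=> _ /cpair_inj [/enc_tf_inj -> ->].
- by move=> _ ->.
- by move=> _ /cpair_inj [/IH1 -> /IH2 ->].
- by move=> _ /IH ->.
- by move=> _ /cpair_inj [/enc_sa_inj -> /IH ->].
- by move=> _ /cpair_inj [-> /IH ->].
Qed.

Lemma enc_hf_inj : injective enc_hf.
Proof.
elim=> [p h IH|p h IH|m] [q g|q g|n] /cpair_inj [] //.
- by move=> _ /cpair_inj [-> /IH ->].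
- by move=> _ /cpair_inj [-> /IH ->].
- by move=> _ /enc_mf_inj ->.
Qed.

Lemma enc_kripke_inj : injective enc_kripke.
Proof.
move=> [n i e l] [n' i' e' l'] /cpair_inj [/= -> /cpair_inj [Hi /cpair_inj [He Hl]]].
have inj_id : injective (id : nat -> nat) by [].
rewrite (enc_list_inj inj_id Hi) (enc_list_inj (enc_list_inj inj_id) Hl).
by congr Kripke; apply: enc_list_inj He => -[x y] [x' y'] /cpair_inj [/= -> ->].
Qed.

Lemma enc_instance_inj h K h' K' :
  enc_instance h K = enc_instance h' K' -> h = h' /\ K = K'.
Proof. by move=> /cpair_inj [/enc_hf_inj -> /enc_kripke_inj ->]. Qed.

(** * Recursive functions computing the code of an instance *)

Definition psucc (f : prf) : prf := PComp PSucc [:: f].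

Definition padd : prf := PRec (PProj 0) (psucc (PProj 1)).

(** Triangular numbers, by [T(n+1) = n + T(n) + 1]. *)
Definition ptri : prf := PRec PZero (psucc (PComp padd [:: PProj 0; PProj 1])).

Definition ppair (f g : prf) : prf :=
  PComp padd [:: PComp ptri [:: PComp padd [:: f; g]]; g].

Definition pconst (n : nat) : prf := iter n psucc PZero.

Lemma peval_proj i xs y : i < size xs -> nth 0 xs i = y -> peval (PProj i) xs y.
Proof. by move=> H <-; constructor. Qed.

Lemma peval_comp1 f g xs y z : peval g xs y -> peval f [:: y] z -> peval (PComp f [:: g]) xs z.
Proof. by move=> Hg; apply: ev_comp; apply: evs_cons Hg (evs_nil _). Qed.

Lemma peval_comp2 f g h xs x y z : peval g xs x -> peval h xs y ->
  peval f [:: x; y] z -> peval (PComp f [:: g; h]) xs z.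
Proof.
by move=> Hg Hh; apply: ev_comp; apply: evs_cons Hg (evs_cons Hh (evs_nil _)).
Qed.

Lemma peval_succ f xs x : peval f xs x -> peval (psucc f) xs x.+1.
Proof. by move=> Hf; apply: peval_comp1 Hf _; constructor. Qed.

Lemma peval_add x y : peval padd [:: x; y] (x + y).
Proof.
elim: x => [|x IH]; first by apply: ev_rec0; apply: peval_proj.
by apply: ev_recS IH _; apply: peval_succ; apply: peval_proj.
Qed.

Lemma peval_tri s : peval ptri [:: s] 'C(s.+1, 2).
Proof.
elim: s => [|s IH]; first by apply: ev_rec0; constructor.
apply: ev_recS IH _; rewrite (binS s.+1) bin1 addnS addnC; apply: peval_succ.
by apply: peval_comp2 (peval_add _ _); apply: peval_proj.
Qed.

Lemma peval_pair f g xs x y :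
  peval f xs x -> peval g xs y -> peval (ppair f g) xs (cpair x y).
Proof.
move=> Hf Hg; rewrite cpairE; apply: (peval_comp2 _ Hg (peval_add _ _)).
by apply: peval_comp1 (peval_tri _); apply: peval_comp2 Hf Hg (peval_add _ _).
Qed.

Lemma peval_const n xs : peval (pconst n) xs n.
Proof. by elim: n => [|n IH]; [constructor | apply: peval_succ]. Qed.

Definition enc_edges (s : seq (nat * nat)) : nat := enc_list (fun e => cpair e.1 e.2) s.

(** The step to [n+1] prepends the edge [(n+4, n+3)]; the outer successor is that of [enc_list]. *)
Definition pedges : prf :=
  PRec (pconst (enc_edges (input_edges 0)))
       (psucc (ppair (ppair (iter 4 psucc (PProj 0)) (iter 3 psucc (PProj 0))) (PProj 1))).

Lemma peval_edges n : peval pedges [:: n] (enc_edges (input_edges n)).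
Proof.
elim: n => [|n IH]; first by apply: ev_rec0; apply: peval_const.
apply: ev_recS IH _; apply: peval_succ; apply: peval_pair; last exact: peval_proj.
by apply: peval_pair; do !apply: peval_succ; apply: peval_proj.
Qed.

(** The diagonal map: [n] serves both as the code of the formula and as the input of the
    structure. *)
Definition pinstance : prf :=
  ppair (PProj 0)
    (ppair (iter 4 psucc (PProj 0))
       (ppair (psucc (ppair (iter 3 psucc (PProj 0)) PZero))
          (ppair pedges (pconst (enc_list (enc_list id) [:: [:: 0]]))))).

Lemma peval_instance h n : enc_hf h = n ->
  peval pinstance [:: n] (enc_instance h (input_kripke n)).
Proof.
move=> <-; have P0 : peval (PProj 0) [:: enc_hf h] (enc_hf h) by apply: peval_proj.
apply: peval_pair => //; apply: peval_pair; first by do 4 apply: peval_succ.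
apply: peval_pair.
  by apply: peval_succ; apply: peval_pair; [do 3 apply: peval_succ | constructor].
apply: peval_pair; [exact: peval_edges | exact: peval_const].
Qed.

Theorem theorem4p1 :
  ~ decidable_nat (fun n => exists (h : hf) (K : kripke),
      [/\ n = enc_instance h K, hf_closed h, kripke_wf K & models (Traces K) h]).
Proof.
move=> [f Hf].
(* Register 0 is the argument and register 1 the output; [k] is at least 2 so that register 1 has
   its traces. *)
pose c := comp (PComp f [:: pinstance]) [:: 0] 1 2; pose k := maxn 2 (regs c).
have Hc : regs c <= k by rewrite leq_maxr.
have Hk : 1 < k by rewrite leq_maxl.
pose h := prog_hf k c; pose n := enc_hf h; pose K := input_kripke n.
have [Hyes Hno] := Hf (enc_instance h K).
have Hrun y : peval f [:: enc_instance h K] y ->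
    exists2 s', halts_in c (fun=> n) s' & s' 1 = y.
  move=> Hy; have [||||s' [H1 H2 _]] := @comp_correct (PComp f [:: pinstance])
    [:: n] y [:: 0] 1 2 (fun=> n).
  - by apply: peval_comp1 Hy; apply: peval_instance.
  - by [].
  - by move=> r; rewrite inE => /eqP->.
  - by [].
  - by exists s'.
(* If [h] held, the decider would output 1, while [h] provides a run with output 0. *)
have HnP : ~ models (Traces K) h.
  move=> /(models_prog_hf n Hc Hk) [s2 H2 E2].
  have [|s1 [l1 H1] E1] := Hrun 1.
    apply: Hyes; exists h, K; split=> //; first exact: prog_hf_closed.
      exact: input_kripke_wf.
    by apply/(models_prog_hf n Hc Hk); exists s2.
  by move: E2; rewrite -(exec_det H1 H2) E1.
(* As [h] fails and the code has no other decoding, the decider outputs 0; but this run makes [h]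
   true. *)
apply: (HnP); apply/(models_prog_hf n Hc Hk); apply: Hrun; apply: Hno.
by move=> [h' [K' [/enc_instance_inj [<- <-] _ _]]].
Qed.
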